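(* Let $P_n$ denote the path on $n$ vertices. Then $c_2(P_3)=2$, $c_2(P_n)=n$ for $n=4,5,6$, and $c_2(P_n)=n+1$ for all $n\ge 7$.
   Context: All graphs are finite and simple. Let $G$ be a graph and $k\ge 2$ an integer. A multiset $\mathscr{P}$ of paths in $G$ is a $k$-rainbow separating path system ($k$-RSPS) if its elements can be colored with (at most) $k$ colors so that for every pair of distinct edges $e_1,e_2\in E(G)$ there exist paths $P_1,P_2\in\mathscr{P}$ of distinct colors such that $P_1$ contains $e_1$ but not $e_2$, and $P_2$ contains $e_2$ but not $e_1$. The $k$-rainbow separation number $c_k(G)$ is the smallest cardinality (with multiplicity) of a $k$-RSPS of $G$. *)

(* Defs.v *)
From mathcomp Require Import all_boot.
From mathcomp Require Import boolp.

Set Implicit Arguments.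
Unset Strict Implicit.
Unset Printing Implicit Defensive.

Record sgraph := SGraph {
  vertex :> finType;
  adj : rel vertex;
  adj_sym : symmetric adj;
  adj_irr : irreflexive adj }.

Definition edges (G : sgraph) : {set {set G}} :=
  [set e | [exists x, exists y, adj x y && (e == [set x; y])]].

(* A path is given by its sequence of distinct vertices; the two orientations
   of a path have the same edges, and single-vertex paths are allowed. *)
Definition is_gpath (G : sgraph) (p : seq G) : bool :=
  if p is x :: q then path (@adj G) x q && uniq p else false.

Definition path_edges (G : sgraph) (p : seq G) : seq {set G} :=
  [seq [set u.1; u.2] | u <- zip p (behead p)].

(* A sequence P stands for a multiset of paths. Its elements are coloured by
   position, so that copies of the same path may receive different colours. *)
Definition is_rsps (k : nat) (G : sgraph) (P : seq (seq G)) : Prop :=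
  all (@is_gpath G) P /\
  exists c : 'I_(size P) -> 'I_k,
    forall e1 e2 : {set G}, e1 \in edges G -> e2 \in edges G -> e1 != e2 ->
    exists i j : 'I_(size P),
      [/\ c i != c j,
          e1 \in path_edges (nth [::] P i),
          e2 \notin path_edges (nth [::] P i),
          e2 \in path_edges (nth [::] P j)
        & e1 \notin path_edges (nth [::] P j)].

Definition rsps_size (k : nat) (G : sgraph) (m : nat) : Prop :=
  exists2 P : seq (seq G), is_rsps k P & size P = m.

(* The value 0 is taken only if G has no k-RSPS at all; by rsps_exists below
   this does not happen for k >= 2. *)
Definition rainbow_sepnum (k : nat) (G : sgraph) : nat :=
  if pselect (exists m, `[< rsps_size k G m >]) is left ex then ex_minn ex
  else 0.

(* Two copies of each edge, one in each of two colours. *)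
Lemma rsps_exists (k : nat) (G : sgraph) :
  1 < k -> exists m, `[< rsps_size k G m >].
Proof.
move=> k1; pose ps := [seq [:: u.1; u.2] | u : G * G in [pred u | adj u.1 u.2]].
exists (size (ps ++ ps)); apply/asboolP; exists (ps ++ ps) => //; split.
  rewrite all_cat andbb; apply/allP => p /mapP[u]; rewrite mem_enum inE => a ->.
  rewrite /= a inE andbT /= andbT; apply: contraTneq a => ->.
  by rewrite adj_irr.
pose c0 : 'I_k := Ordinal (ltnW k1); pose c1 : 'I_k := Ordinal k1.
exists (fun i => if i < size ps then c0 else c1) => e1 e2.
have eP (e : {set G}) : e \in edges G ->
    exists2 i, i < size ps & path_edges (nth [::] ps i) = [:: e].
  rewrite inE => /existsP[x /existsP[y /andP[a /eqP ->]]].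
  have h : [:: x; y] \in ps.
    by apply/mapP; exists (x, y); rewrite // mem_enum inE.
  by exists (index [:: x; y] ps); rewrite ?index_mem ?nth_index.
move=> /eP[i li ei] /eP[j lj ej] ne.
have hi : i < size (ps ++ ps) by rewrite size_cat ltn_addr.
have hj : size ps + j < size (ps ++ ps) by rewrite size_cat ltn_add2l.
exists (Ordinal hi), (Ordinal hj) => /=.
rewrite !nth_cat li ltnNge leq_addr /= addKn ei ej !inE !eqxx ne.
by rewrite eq_sym ne.
Qed.

Lemma rainbow_sepnumP (k : nat) (G : sgraph) : 1 < k ->
  rsps_size k G (rainbow_sepnum k G) /\
  forall P : seq (seq G), is_rsps k P -> rainbow_sepnum k G <= size P.
Proof.
move=> k1; rewrite /rainbow_sepnum; case: pselect => [ex|]; last first.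
  by case; apply: rsps_exists.
case: ex_minnP => m /asboolP hm min; split=> // P hP.
by apply: min; apply/asboolP; exists P.
Qed.

Definition path_adj (n : nat) : rel 'I_n :=
  fun i j => (i.+1 == j :> nat) || (j.+1 == i :> nat).

Lemma path_adj_sym (n : nat) : symmetric (@path_adj n).
Proof. by move=> i j; rewrite /path_adj orbC. Qed.

Lemma path_adj_irr (n : nat) : irreflexive (@path_adj n).
Proof. by move=> i; rewrite /path_adj orbb gtn_eqF. Qed.

Definition path_graph (n : nat) : sgraph :=
  SGraph (@path_adj_sym n) (@path_adj_irr n).

(* Main.v *)
Require Import Defs.
From mathcomp Require Import all_boot.
From mathcomp Require Import boolp.
From mathcomp Require Import zify.

Set Implicit Arguments.
Unset Strict Implicit.
Unset Printing Implicit Defensive.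

(** A path of P_n is an interval of its m = n - 1 consecutive edges e_0, ...,
e_(m-1), so the question is about families of coloured intervals. Two facts
give the lower bounds.

First, call an edge monochromatic if all intervals through it have one colour.
Distinct edges lie in intervals of distinct colours, so there is at most one
monochromatic edge of each colour, hence at most two in all
([not_three_mono]).

Second, separating e_u from e_(u+1) takes an interval r_u that stops between
them and an interval l_u of the other colour that starts between them. For any
cut i the m - 1 intervals r_u (u < i) and l_u (u >= i) are pairwise distinct,
and none of them contains e_i ([outer_inj], [neq_outer]). If e_i is not
monochromatic, two further intervals contain it, so there are at least m + 1
intervals. If e_(i+1) is not monochromatic either, then r_i, an interval
through e_i of the colour of l_i and an interval through e_(i+1) of the colour
of r_i are three further intervals, so there are at least m + 2
([card_of_adjacent_not_mono]). With m intervals and m >= 3 all edges would be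
monochromatic; with m + 1 intervals and m >= 6 one edge of each of the pairs
{e_0, e_1}, {e_2, e_3}, {e_4, e_5} would be. Both are impossible.

For the upper bounds, slide a window of w + 1 edges along the line, cutting it
off at the two ends: this gives m + w intervals, the t-th of which contains e_i
exactly if i <= t <= i + w. Separation then becomes a condition on the sequence
of colours ([windows_rsps]). Alternating colours satisfy it for w = 2 and every
m, and for w = 0 and m = 2. For w = 1, windows t and t + 2 must differ in
colour, which makes every second edge monochromatic; the colours 0 1 1 0 0 1
work up to m = 5. *)

(** * Rainbow separation by intervals of a line *)

Section Intervals.

Variables (T : finType) (cov : T -> nat -> bool) (c : T -> bool).

Definition interval_cover :=
  forall x e f g, e <= f <= g -> cov x e -> cov x g -> cov x f.

Definition rainbow_separates (m : nat) :=
  forall e f, e < m -> f < m -> e != f ->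
  exists x y, [/\ c x != c y, cov x e, ~~ cov x f, cov y f & ~~ cov y e].

Definition mono_in (b : bool) (e : nat) : bool :=
  [forall x, cov x e ==> (c x == b)].

Definition mono (e : nat) : bool := mono_in true e || mono_in false e.

Lemma not_mono_color e b : ~~ mono e -> exists2 x, cov x e & c x = b.
Proof.
have get b' : ~~ mono_in (~~ b') e -> exists2 x, cov x e & c x = b'.
  move=> /forallPn[x]; rewrite negb_imply => /andP[xe cx]; exists x => //.
  by case: b' (c x) cx => [] [].
by rewrite negb_or => /andP[nt nf]; apply: get; case: b.
Qed.

Lemma mono_colors_differ m e f b : rainbow_separates m ->
  e < m -> f < m -> e != f -> mono_in b e -> ~~ mono_in b f.
Proof.
move=> sep em fm ef /forallP me; apply/negP => /forallP mf.
have [x [y [cxy xe _ yf _]]] := sep e f em fm ef.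
by move: (me x) (mf y) cxy; rewrite xe yf /= => /eqP-> /eqP->; rewrite eqxx.
Qed.

Lemma not_three_mono m e f g : rainbow_separates m -> e < f < g -> g < m ->
  mono e -> mono f -> mono g -> False.
Proof.
move=> sep /andP[ef fg] gm.
have diff b e' f' : e' < m -> f' < m -> e' != f' -> mono_in b e' ->
    ~ mono_in b f'.
  by move=> em fm nef me; apply/negP/(mono_colors_differ sep em fm nef me).
have em : e < m by lia.
have fm : f < m by lia.
have nef : e != f by lia.
have neg : e != g by lia.
have nfg : f != g by lia.
case/orP=> me /orP[] mf /orP[] mg;
  first [exact: (diff _ _ _ em fm nef me mf)|exact: (diff _ _ _ em gm neg me mg)
        |exact: (diff _ _ _ fm gm nfg mf mg)].
Qed.

Hypothesis icov : interval_cover.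

(** The paths that separate two consecutive edges: [r u] stops, and [l u]
starts, at the vertex between the edges [u] and [u.+1]. *)
Lemma junction_paths k : rainbow_separates k.+1 ->
  exists r l : 'I_k -> T, forall u : 'I_k,
    [/\ c (r u) != c (l u), cov (r u) u, ~~ cov (r u) u.+1,
        cov (l u) u.+1 & ~~ cov (l u) u].
Proof.
move=> sep; have h (u : 'I_k) : exists p : T * T,
    [/\ c p.1 != c p.2, cov p.1 u, ~~ cov p.1 u.+1, cov p.2 u.+1
      & ~~ cov p.2 u].
  have uk := ltn_ord u.
  have [||| x [y h]] := sep u u.+1; try lia.
  by exists (x, y).
have [p hp] := fin_all_exists h.
by exists (fun u => (p u).1), (fun u => (p u).2).
Qed.

Section Junctions.

Variables (k : nat) (r l : 'I_k -> T).
Hypothesis rlP : forall u : 'I_k,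
    [/\ c (r u) != c (l u), cov (r u) u, ~~ cov (r u) u.+1,
        cov (l u) u.+1 & ~~ cov (l u) u].

Lemma neq_right x e (u : 'I_k) : cov x e -> u < e -> x != r u.
Proof.
move=> xe ue; apply: contraTneq xe => ->; have [_ ru nru _ _] := rlP u.
by apply: contra nru => re; apply: icov ru re; lia.
Qed.

Lemma neq_left x e (u : 'I_k) : cov x e -> e <= u -> x != l u.
Proof.
move=> xe ue; apply: contraTneq xe => ->; have [_ _ _ lu nlu] := rlP u.
by apply: contra nlu => le; apply: icov le lu; lia.
Qed.

(** Paths lying strictly to the left or strictly to the right of the edge [i],
one for each inner vertex of the line. *)
Definition outer (i : nat) (u : 'I_k) : T := if u < i then r u else l u.

Lemma outer_inj i : injective (outer i).
Proof.
suff lt (u v : 'I_k) : u < v -> outer i u != outer i v.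
  move=> u v /eqP; have [/lt/negPf->//|/lt|/val_inj//] := ltngtP u v.
  by rewrite eq_sym => /negPf->.
rewrite /outer => uv.
have [_ ru _ lu _] := rlP u; have [_ rv _ lv _] := rlP v.
case: ltnP => ui; case: ltnP => vi; try lia.
- by rewrite eq_sym; apply: neq_right rv _.
- by rewrite eq_sym; apply: neq_right lv _; lia.
- exact: neq_left lu _.
Qed.

Lemma card_outside_outer i (U : {set T}) :
  (forall x u, x \in U -> x != outer i u) -> #|U| + k <= #|T|.
Proof.
move=> UP; rewrite -[k in _ + k]card_ord -(card_imset _ (@outer_inj i)).
rewrite -cardsUI (_ : _ :&: _ = set0) ?cards0 ?addn0 ?max_card //.
apply/setP => x; rewrite !inE; apply/negP => /andP[xU /imsetP[u _ xu]].
by have := UP x u xU; rewrite xu eqxx.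
Qed.

Lemma neq_outer x i (u : 'I_k) : cov x i -> x != outer i u.
Proof.
rewrite /outer => xi; case: ltnP => ui; first exact: neq_right xi ui.
exact: neq_left xi ui.
Qed.

End Junctions.

(** The two colours present on the edge [i] give two paths through it, besides
the [outer] ones. *)
Lemma card_of_not_mono m i : rainbow_separates m -> i < m -> ~~ mono i ->
  m < #|T|.
Proof.
case: m => [//|k] sep im ni; have [r [l rl]] := junction_paths sep.
have [x xi cx] := not_mono_color true ni; have [y yi cy] := not_mono_color false ni.
have xy : x != y by apply: contraTneq cx => ->; rewrite cy.
suff : #|[set x; y]| + k <= #|T| by rewrite cards2 xy.
apply: (card_outside_outer rl (i := i)) => z u.
by rewrite !inE => /orP[] /eqP->; apply: neq_outer.
Qed.

(** If both edges are bicoloured, then so many paths meet at the vertex [v]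
between them that one can be added to the count. The third path [z] need not
contain the edge [i], but its colour keeps it apart from [l v], the only
[outer] path that it could equal. *)
Lemma card_of_adjacent_not_mono m i : rainbow_separates m -> i.+1 < m ->
  ~~ mono i -> ~~ mono i.+1 -> m.+1 < #|T|.
Proof.
case: m => [//|k] sep im ni ni1; have [r [l rl]] := junction_paths sep.
pose v : 'I_k := Ordinal (im : i < k).
have [crl ri nri li nli] := rl v.
have [y yi cy] := not_mono_color (c (l v)) ni.
have [z zi cz] := not_mono_color (c (r v)) ni1.
have rz : r v != z by apply: contraNneq nri => ->.
have ry : r v != y by apply: contraNneq crl => ->; rewrite cy.
have zy : z != y by apply: contraNneq crl => zy; rewrite -cz -cy zy.
suff : #|[set r v; z; y]| + k <= #|T|.
  by rewrite setUC cardsU1 cards2 rz !inE negb_or eq_sym ry eq_sym zy.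
apply: (card_outside_outer rl (i := i)) => x u.
rewrite !inE -orbA => /or3P[] /eqP->; try exact: neq_outer.
rewrite /outer; case: ltnP => ui.
  by apply: neq_right rl _ _ _ zi _; lia.
have [uv|uv] := eqVneq (u : nat) i.
  have -> : u = v by apply: val_inj.
  by apply: contraNneq crl => zl; rewrite -cz zl.
by apply: neq_left rl _ _ _ zi _; lia.
Qed.

(** With at most [m] paths every edge would be monochromatic, and a line with
more than two edges has too many of them. *)
Theorem separates_card_gt m : rainbow_separates m -> 2 < m -> m < #|T|.
Proof.
move=> sep m2; have [//|Tm] := ltnP m #|T|.
have M e : e < m -> mono e.
  by move=> em; apply: contraLR Tm => /(card_of_not_mono sep em); rewrite -ltnNge.
by case: (@not_three_mono m 0 1 2 sep) => //; apply: M; lia.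
Qed.

(** With at most [m.+1] paths there would be a monochromatic edge in each pair
of consecutive edges, and six edges contain three disjoint pairs. *)
Theorem separates_card_gtS m : rainbow_separates m -> 5 < m -> m.+1 < #|T|.
Proof.
move=> sep m5; have [//|Tm] := ltnP m.+1 #|T|.
have M e : e.+1 < m -> exists2 f, e <= f <= e.+1 & mono f.
  move=> em; have [me|ne] := boolP (mono e).
    by exists e; rewrite ?leqnn ?leqnSn.
  exists e.+1; first by rewrite leqnSn leqnn.
  by apply: contraLR Tm => /(card_of_adjacent_not_mono sep em ne); rewrite -ltnNge.
have [|f0 h0 m0] := M 0; first lia.
have [|f1 h1 m1] := M 2; first lia.
have [|f2 h2 m2] := M 4; first lia.
by case: (@not_three_mono m f0 f1 f2 sep) => //; lia.
Qed.

End Intervals.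

(** * Edges and paths of the path graph *)

Definition line_edge (n i : nat) : {set 'I_n} :=
  [set v : 'I_n | (v == i :> nat) || (v == i.+1 :> nat)].

Lemma line_edgeE n (x y : 'I_n) : x.+1 = y -> [set x; y] = line_edge n x.
Proof. by move=> xy; apply/setP => v; rewrite !inE -!val_eqE /= xy. Qed.

Lemma line_edge_inj n i j : i.+1 < n -> line_edge n i = line_edge n j -> i = j.
Proof.
move=> ni /setP eij; have := eij (Ordinal ni); have := eij (Ordinal (ltnW ni)).
by rewrite !inE /=; lia.
Qed.

Lemma edge_of_adj n (x y : path_graph n) : adj x y ->
  exists2 i, i.+1 < n & [set x; y] = line_edge n i.
Proof.
case/orP => /eqP xy.
  by exists (nat_of_ord x); [rewrite xy ltn_ord|apply: line_edgeE].
by exists (nat_of_ord y); [rewrite xy ltn_ord|rewrite setUC; apply: line_edgeE].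
Qed.

Lemma edges_lineP n (e : {set path_graph n}) :
  reflect (exists2 i, i.+1 < n & e = line_edge n i) (e \in edges (path_graph n)).
Proof.
apply: (iffP idP) => [|[i ni ->]].
  by rewrite inE => /existsP[x /existsP[y /andP[xy /eqP->]]]; apply: edge_of_adj.
rewrite inE; apply/existsP; exists (Ordinal (ltnW ni)).
apply/existsP; exists (Ordinal ni); rewrite /= /path_adj /= eqxx /=.
by apply/eqP/esym/line_edgeE.
Qed.

Lemma path_edges_cons (G : sgraph) (x y : G) q :
  path_edges [:: x, y & q] = [set x; y] :: path_edges (y :: q).
Proof. by []. Qed.

(** Removing an edge disconnects the line. *)
Lemma same_side n j (x : path_graph n) q : path (@adj (path_graph n)) x q ->
  line_edge n j \notin path_edges (x :: q) ->
  forall y : 'I_n, y \in x :: q -> ((y : nat) <= j) = ((x : 'I_n) <= j).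
Proof.
elim: q x => [|z q IH] x /=; first by move=> _ _ y; rewrite inE => /eqP->.
move=> /andP[xz /IH{}IH]; rewrite path_edges_cons inE negb_or.
move=> /andP[jx /IH{}IH] y.
have zx : ((z : nat) <= j) = ((x : nat) <= j).
  case/orP: xz jx => /eqP xz; last rewrite setUC.
    rewrite (line_edgeE xz); have [->|] := eqVneq (x : nat) j; first by rewrite eqxx.
    by lia.
  rewrite (line_edgeE xz); have [->|] := eqVneq (z : nat) j; first by rewrite eqxx.
  by lia.
by rewrite inE => /predU1P[->//|/IH->].
Qed.

Lemma path_edges_mem (G : sgraph) (p : seq G) (e : {set G}) :
  e \in path_edges p -> exists x, (x \in p) && (x \in e).
Proof.
elim: p => [//|x [//|y q] IH]; rewrite path_edges_cons inE.
case/predU1P=> [->|/IH[z /andP[zq ze]]].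
  by exists x; rewrite !inE !eqxx.
by exists z; rewrite inE zq orbT.
Qed.

Lemma gpath_interval n (p : seq (path_graph n)) i j k : is_gpath p ->
  i <= j <= k -> line_edge n i \in path_edges p ->
  line_edge n k \in path_edges p -> line_edge n j \in path_edges p.
Proof.
case: p => [//|x q] /andP[pq _] /andP[ij jk] ip kp.
have [ij'|nij] := eqVneq i j; first by rewrite -ij'.
have [jk'|njk] := eqVneq j k; first by rewrite jk'.
apply/negPn/negP => /(same_side pq) side.
have [y /andP[/side sy]] := path_edges_mem ip.
have [z /andP[/side sz]] := path_edges_mem kp.
by rewrite !inE; lia.
Qed.

Lemma rsps_interval_system n (P : seq (seq (path_graph n))) : is_rsps 2 P ->
  exists (cov : 'I_(size P) -> nat -> bool) (c : 'I_(size P) -> bool),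
    interval_cover cov /\ rainbow_separates cov c n.-1.
Proof.
case=> /allP gP [c sep].
exists (fun (x : 'I_(size P)) i => line_edge n i \in path_edges (nth [::] P x)).
exists (fun x => c x == ord0); split=> [x e f g|e f em fm ef].
  by apply: gpath_interval; apply/gP/mem_nth.
have [|||x [y [cxy xe xf yf ye]]] := sep (line_edge n e) (line_edge n f).
- by apply/edges_lineP; exists e => //; lia.
- by apply/edges_lineP; exists f => //; lia.
- by apply: contraNneq ef => /line_edge_inj->//; lia.
exists x, y; split=> //; apply: contraNneq cxy.
by case: (c x) (c y) => [[|[|[]//]] ?] [[|[|[]//]] ?] //= _; apply/eqP/val_inj.
Qed.

(** * Systems of sliding windows *)

(** The path from vertex [a] to vertex [a + len]; the lemmas below ask for
[a + len <= m], so that [inord] never takes its default value. *)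
Definition segment m a len : seq (path_graph m.+1) :=
  [seq (inord v : 'I_m.+1) | v <- iota a len.+1].

Lemma segment_gpath m a len : a + len <= m -> is_gpath (segment m a len).
Proof.
move=> am; apply/andP; split; last first.
  rewrite -/(uniq (segment m a len)) map_inj_in_uniq ?iota_uniq // => u v.
  rewrite !mem_iota => uh vh /(congr1 (@nat_of_ord _)).
  by rewrite !inordK; lia.
elim: len a am => [//|len IH] a am /=.
rewrite [X in _ && X]IH ?andbT; last by lia.
by apply/orP; left; rewrite !inordK //; lia.
Qed.

Lemma segment_edges m a len : a + len <= m ->
  path_edges (segment m a len) = [seq line_edge m.+1 i | i <- iota a len].
Proof.
elim: len a => [//|len IH] a am.
rewrite /segment /= path_edges_cons -/(segment m a.+1 len) IH; last by lia.
by rewrite line_edgeE inordK ?inordK //; lia.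
Qed.

Lemma mem_segment m a len i : a + len <= m -> i < m ->
  (line_edge m.+1 i \in path_edges (segment m a len)) = (a <= i < a + len).
Proof.
move=> am im; rewrite segment_edges // -mem_iota.
apply/mapP/idP => [[j ja /line_edge_inj->//]|ia]; by exists i.
Qed.

(** The edges from [t - w] to [t], as far as they exist. Truncated subtraction
cuts the window off on the left, the minimum cuts it off on the right. *)
Definition window m w t : seq (path_graph m.+1) :=
  segment m (t - w) (minn t.+1 m - (t - w)).

Lemma window_gpath m w t : t < m + w -> is_gpath (window m w t).
Proof. by move=> tm; apply: segment_gpath; lia. Qed.

Lemma mem_window m w t i : t < m + w -> i < m ->
  (line_edge m.+1 i \in path_edges (window m w t)) = (i <= t <= i + w).
Proof. by move=> tm im; rewrite mem_segment //; lia. Qed.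

(** Every window [s < f] avoids the edge [f], and every window [t > e + w]
avoids the edge [e]; so the two windows that separate [e < f] can be chosen
from the window numbers alone. *)
Lemma windows_rsps m w (c : nat -> bool) :
  (forall e f, e < f < m -> exists s t,
     [/\ c s != c t, e <= s <= e + w, s < f, e + w < t & f <= t <= f + w]) ->
  rsps_size 2 (path_graph m.+1) (m + w).
Proof.
move=> sep; pose P : seq (seq (path_graph m.+1)) := mkseq (window m w) (m + w).
have sP : size P = m + w by apply: size_mkseq.
exists P => //; split.
  by apply/allP => p /mapP[t]; rewrite mem_iota => tm ->; apply: window_gpath.
pose col (b : bool) : 'I_2 := if b then ord0 else ord_max.
have col_inj : injective col by do 2!case.
exists (fun x => col (c x)).
pose cov (x : 'I_(size P)) i := line_edge m.+1 i \in path_edges (nth [::] P x).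
have covE x i : i < m -> cov x i = (i <= x <= i + w).
  have xm : x < m + w by rewrite -sP.
  by move=> im; rewrite /cov nth_mkseq // mem_window.
have lt e f : e < f < m -> exists x y : 'I_(size P),
    [/\ col (c x) != col (c y), cov x e, ~~ cov x f, cov y f & ~~ cov y e].
  move=> efm; have [s [t [cst es sf et ft]]] := sep e f efm.
  have sx : s < size P by rewrite sP; lia.
  have ty : t < size P by rewrite sP; lia.
  exists (Ordinal sx), (Ordinal ty); rewrite (inj_eq col_inj) !covE /=; try lia.
  by split=> //; lia.
move=> e1 e2 /edges_lineP[e em ->] /edges_lineP[f fm ->] ef.
have [lef|lfe|eqef] := ltngtP e f; last by rewrite eqef eqxx in ef.
  by apply: lt; lia.
have [|x [y [cxy xe xf yf ye]]] := lt f e; first lia.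
by exists y, x; rewrite eq_sym.
Qed.

Lemma rsps_line3 : rsps_size 2 (path_graph 3) 2.
Proof.
apply: (@windows_rsps 2 0 odd) => e f ef.
by exists 0, 1; split=> //; lia.
Qed.

(** Windows of two edges. Consecutive edges are separated only if the
windows [t] and [t + 2] differ in colour for all [t], so the colours have
period 4. Starting them with a change of colour leaves only the edges 1 and 3
monochromatic, and these in different colours. *)
Lemma rsps_line_short m : m <= 5 -> rsps_size 2 (path_graph m.+1) (m + 1).
Proof.
move=> m5; pose colors := [:: true; false; false; true; true; false].
apply: (windows_rsps (c := nth false colors)).
move=> e f /andP[ef fm]; have {m m5 fm} f5 : f < 5 by lia.
case: f ef f5 => [|[|[|[|[|//]]]]]; case: e => [|[|[|[|//]]]] // _ _;
  first [by exists 0, 2|by exists 1, 3|by exists 2, 4|by exists 3, 5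
        |by exists 0, 5|by exists 1, 4|by exists 0, 1|by exists 1, 5
        |by exists 0, 4|by exists 2, 5|by exists 0, 3].
Qed.

(** Windows of three edges in alternating colours. The window [e] ends with the
edge [e]; among the windows [f.+1] and [f.+2], both of which contain [f], one
has the other colour, and it avoids [e]: the first of them is needed only if
[e] and [f] have equal parity, when [f] is at least [e + 2]. *)
Lemma rsps_line m : rsps_size 2 (path_graph m.+1) (m + 2).
Proof.
apply: (windows_rsps (c := odd)) => e f efm.
have [par|par] := eqVneq (odd e) (odd f).
  by exists e, f.+1; split; lia.
by exists e, f.+2; split; lia.
Qed.

Lemma rainbow_sepnum_eq k G s : 1 < k -> rsps_size k G s ->
  (forall P : seq (seq G), is_rsps k P -> s <= size P) ->
  rainbow_sepnum k G = s.
Proof.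
move=> k1 [P hP sP] lb; have [[Q hQ sQ] min] := rainbow_sepnumP G k1.
by apply/eqP; rewrite eqn_leq -{1}sP min // -sQ lb.
Qed.

Theorem theorem2p1 :
  [/\ rainbow_sepnum 2 (path_graph 3) = 2,
      (forall n : nat, 4 <= n <= 6 -> rainbow_sepnum 2 (path_graph n) = n)
    & (forall n : nat, 7 <= n -> rainbow_sepnum 2 (path_graph n) = n + 1)].
Proof.
split=> [|n n46|n n7].
- apply: rainbow_sepnum_eq => // [|P]; first exact: rsps_line3.
  move=> /rsps_interval_system[cov [c [_ sep]]].
  have [//|//|//|x [y [cxy _ _ _ _]]] := sep 0 1.
  have xy : x != y by apply: contraNneq cxy => ->.
  by have := ltn_ord x; have := ltn_ord y; move: xy; rewrite -val_eqE /=; lia.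
- case: n n46 => [//|m] m46; apply: rainbow_sepnum_eq => // [|P].
    by rewrite -[X in rsps_size _ _ X]addn1; apply: rsps_line_short; lia.
  move=> /rsps_interval_system[cov [c [icov sep]]].
  by rewrite -[size P]card_ord; apply: (separates_card_gt icov sep); lia.
- case: n n7 => [//|m] m7; apply: rainbow_sepnum_eq => // [|P].
    by rewrite addSn -addnS; apply: rsps_line.
  move=> /rsps_interval_system[cov [c [icov sep]]].
  by rewrite -[size P]card_ord addn1; apply: (separates_card_gtS icov sep); lia.
Qed.
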